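(* There is an absolute constant $C>0$ such that the following holds for all integers $\ell,k\ge 1$ and all $\varepsilon\in(0,0.1)$. Let $g:\{0,1\}^\ell\to\{0,1\}$ be computed by a CNF formula all of whose clauses have width at most $k$, and let $$d:=C\,\ell^{k/(k+1)}\,\log^{2/(k+1)}(1/\varepsilon).$$ Then there exists a real polynomial $q$ in $\ell$ variables of degree at most $d$ such that (i) for every $x\in\{0,1\}^\ell$ with $g(x)=1$ we have $q(x)=1$; (ii) $|q(x)-g(x)|\le\varepsilon$ for all $x\in\{0,1\}^\ell$; (iii) the sum of the absolute values of the coefficients of $q$ is at most $32^d$.
   Context: A CNF formula is an AND of clauses; a clause is an OR of literals ($x_i$ or $\neg x_i$); its width is its number of literals. $\log$ denotes the base-2 logarithm, and $\log^{a}(y)$ means $(\log y)^{a}$. *)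

(* Defs.v *)
From HB Require Import structures.
From mathcomp Require Export all_boot all_order all_algebra.
From mathcomp Require Export reals exp.
From mathcomp Require Export mpoly.

Set Implicit Arguments.
Unset Strict Implicit.
Unset Printing Implicit Defensive.

Import Order.TTheory GRing.Theory Num.Theory.
Local Open Scope ring_scope.

Definition cube (l : nat) := {ffun 'I_l -> bool}.

(* (i, true) is the literal x_i and (i, false) is its negation. *)
Definition literal (l : nat) := ('I_l * bool)%type.
Definition clause (l : nat) := seq (literal l).
Definition cnf (l : nat) := seq (clause l).

Definition literal_eval (l : nat) (x : cube l) (u : literal l) : bool :=
  x u.1 == u.2.
Definition clause_eval (l : nat) (x : cube l) (c : clause l) : bool :=
  has (literal_eval x) c.
Definition cnf_eval (l : nat) (x : cube l) (phi : cnf l) : bool :=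
  all (clause_eval x) phi.

Definition clause_width (l : nat) (c : clause l) : nat := size c.

Definition computed_by_kcnf (l k : nat) (g : cube l -> bool) : Prop :=
  exists2 phi : cnf l,
    all (fun c => clause_width c <= k)%N phi & forall x, cnf_eval x phi = g x.

Definition log2 (R : realType) (y : R) : R := ln y / ln 2.

(* msize is the total degree plus one; the zero polynomial gets degree 0. *)
Definition mpoly_degree (R : realType) (l : nat) (q : {mpoly R[l]}) : nat :=
  (msize q).-1.

Definition mpoly_eval (R : realType) (l : nat) (q : {mpoly R[l]}) (x : cube l)
  : R := q.@[fun i => (x i)%:R].

Definition coef_abs_sum (R : realType) (l : nat) (q : {mpoly R[l]}) : R :=
  \sum_(m <- msupp q) `|q@_m|.

(* Main.v *)
(* A random walk s_0, s_1, ... on words s in [l]^r resamples one coordinate per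
   step. A word is marked for x if some clause whose variables all occur in it
   is falsified by x. Let N be the walk operator killed at the marked words and
   scaled by 1/c, and put
     q(x) = <1, T_m(N) 1> / (l^r T_m(1/c)),
   T_m being the Chebyshev polynomial. If g(x) = 1 nothing is killed and
   q(x) = 1. If g(x) = 0 the marked words have density
   delta >= (r/(32 l))^k, so by the Efron-Stein inequality the killed walk has
   norm at most 1 - delta/r; with c at least this value, N is a contraction, so
   is T_m(N), and |q(x)| <= 1/T_m(1/c) is exponentially small in
   m sqrt(delta/r). A trajectory of m steps reads at most r + m variables, which
   bounds the degree and the coefficients. Balancing
   r against m = O(sqrt(r/delta) log(1/eps)) gives
   r ~ l^(k/(k+1)) log^(2/(k+1))(1/eps). *)
From HB Require Import structures.
Require Import Defs.
From mathcomp Require Import sequences zify ring lra.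
Set Implicit Arguments.
Unset Strict Implicit.
Unset Printing Implicit Defensive.
Import Order.TTheory GRing.Theory Num.Theory.
Local Open Scope ring_scope.

Definition update (I : finType) (T : Type) (s : {ffun I -> T}) (i : I) (a : T)
  : {ffun I -> T} := [ffun j => if j == i then a else s j].

(** * Degree and coefficient norm of functions on the cube *)

Section CoefNorm.
Variables (R : realType) (l : nat).
Implicit Types (p q : {mpoly R[l]}) (f : cube l -> R).

Lemma coef_abs_sum_widen p (s : seq 'X_{1..l}) :
  uniq s -> {subset msupp p <= s} ->
  coef_abs_sum p = \sum_(m <- s) `|p@_m|.
Proof.
move=> s_uniq sub_s; rewrite (bigID (mem (msupp p))) /= [X in _ + X]big1.
  rewrite addr0 -big_filter; apply/perm_big/uniq_perm => //.
    by rewrite filter_uniq.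
  move=> m; rewrite mem_filter; case: (boolP (m \in msupp p)) => //= m_p.
  by rewrite sub_s.
by move=> m /memN_msupp_eq0 ->; rewrite normr0.
Qed.

Lemma coef_abs_sumD p q :
  coef_abs_sum (p + q) <= coef_abs_sum p + coef_abs_sum q.
Proof.
pose s := undup (msupp p ++ msupp q).
have s_uniq : uniq s by exact: undup_uniq.
rewrite (@coef_abs_sum_widen _ s) //; last first.
  by move=> m /msuppD_le; rewrite mem_undup.
rewrite (@coef_abs_sum_widen p s) //; last first.
  by move=> m m_p; rewrite mem_undup mem_cat m_p.
rewrite (@coef_abs_sum_widen q s) //; last first.
  by move=> m m_q; rewrite mem_undup mem_cat m_q orbT.
rewrite -big_split /=; apply: ler_sum => m _.
by rewrite mcoeffD ler_normD.
Qed.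

Lemma coef_abs_sumZ c p : coef_abs_sum (c *: p) = `|c| * coef_abs_sum p.
Proof.
rewrite (@coef_abs_sum_widen (c *: p) (msupp p)) ?msupp_uniq //; last first.
  exact: msuppZ_le.
rewrite mulr_sumr; apply: eq_bigr => m _.
by rewrite mcoeffZ normrM.
Qed.

Lemma coef_abs_sumMX p m : coef_abs_sum (p * 'X_[m]) = coef_abs_sum p.
Proof.
rewrite /coef_abs_sum (perm_big _ (msuppMX p m)) big_map.
by apply: eq_bigr => m' _; rewrite mcoeffMX.
Qed.

Definition representable (e : nat) (K : R) f :=
  exists q : {mpoly R[l]},
    [/\ (msize q <= e.+1)%N, coef_abs_sum q <= K
      & forall x, mpoly_eval q x = f x].

Lemma representable_ext e K f f' :
  f =1 f' -> representable e K f -> representable e K f'.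
Proof. by move=> eq_f [q [? ? qE]]; exists q; split=> // x; rewrite qE. Qed.

Lemma representable_weaken e e' K K' f :
  (e <= e')%N -> K <= K' -> representable e K f -> representable e' K' f.
Proof.
move=> le_e le_K [q [q_size q_norm qE]]; exists q; split=> //.
  exact: leq_trans q_size _.
exact: le_trans q_norm le_K.
Qed.

Lemma representableD e K K' f f' :
  representable e K f -> representable e K' f' ->
  representable e (K + K') (fun x => f x + f' x).
Proof.
move=> [q [q_size q_norm qE]] [q' [q'_size q'_norm q'E]]; exists (q + q').
split=> [||x].
- by rewrite (leq_trans (msizeD_le _ _)) // geq_max q_size.
- exact: le_trans (coef_abs_sumD _ _) (lerD q_norm q'_norm).
- by rewrite /mpoly_eval mevalD; congr (_ + _); [exact: qE | exact: q'E].
Qed.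

Lemma representableZ e K c f :
  representable e K f -> representable e (`|c| * K) (fun x => c * f x).
Proof.
move=> [q [q_size q_norm qE]]; exists (c *: q); split=> [||x].
- exact: leq_trans (msizeZ_le _ _) q_size.
- by rewrite coef_abs_sumZ ler_wpM2l.
- by rewrite /mpoly_eval mevalZ; congr (_ * _); exact: qE.
Qed.

Lemma representable0 e : representable e 0 (fun=> 0).
Proof.
exists 0; split=> [||x]; first by rewrite msize0.
- by rewrite /coef_abs_sum msupp0 big_nil.
- by rewrite /mpoly_eval meval0.
Qed.

Lemma representable_sum (I : finType) e K (F : I -> cube l -> R) :
  (forall i, representable e K (F i)) ->
  representable e (#|I|%:R * K) (fun x => \sum_i F i x).
Proof.
move=> FK; rewrite cardE enumT mulr_natl.
apply: (representable_ext (f := fun x => \sum_(i <- Finite.enum I) F i x)) => //.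
elim: (Finite.enum I) => [|i s IHs] /=.
  by apply: representable_ext (representable0 e) => x; rewrite big_nil.
rewrite mulrS; apply: representable_ext (representableD (FK i) IHs) => x.
by rewrite big_cons.
Qed.

(** The triangle inequality loses a factor [#|I|] that the normalisation returns, so averaging over
    the choices of the walk is free. *)
Lemma representable_mean (I : finType) e K (F : I -> cube l -> R) :
  (0 < #|I|)%N -> (forall i, representable e K (F i)) ->
  representable e K (fun x => #|I|%:R^-1 * \sum_i F i x).
Proof.
move=> I_gt0 /representable_sum /(representableZ #|I|%:R^-1).
by rewrite ger0_norm ?invr_ge0 // mulKf // pnatr_eq0 -lt0n.
Qed.

Lemma representable_var e K i f :
  representable e K f -> representable e.+1 K (fun x => f x * (x i)%:R).
Proof.
move=> [q [q_size q_norm qE]]; exists (q * 'X_i); split=> [||x].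
- have [->|q_neq0] := eqVneq q 0; first by rewrite mul0r msize0.
  have X_neq0 : 'X_i != 0 :> {mpoly R[l]} by rewrite -msize_poly_eq0 msizeX mdeg1.
  by rewrite msizeM // msizeX mdeg1 addn2.
- by rewrite coef_abs_sumMX.
- by rewrite /mpoly_eval mevalM mevalXU; congr (_ * _); exact: qE.
Qed.

(** [B] is a list, possibly with repetitions, so that its length can serve directly as a degree
    bound. The bound by 1 survives products and the fixing of variables. *)
Definition junta (B : seq 'I_l) f :=
  (forall x y : cube l, {in B, forall i, x i = y i} -> f x = f y) /\ (forall x, `|f x| <= 1).

Lemma junta_subset B B' f : {subset B <= B'} -> junta B f -> junta B' f.
Proof.
move=> sub_B [f_B f_1]; split=> // x y xy; apply: f_B => i /sub_B; exact: xy.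
Qed.

Lemma juntaM B f f' : junta B f -> junta B f' -> junta B (fun x => f x * f' x).
Proof.
move=> [f_B f_1] [f'_B f'_1]; split=> [x y xy|x].
  by rewrite (f_B _ y) ?(f'_B _ y).
by rewrite normrM mulr_ile1.
Qed.

(* Shannon expansion f = f_0 (1 - x_i) + f_1 x_i = f_0 + f_1 x_i - f_0 x_i
   raises the degree by one and at most triples the norm. *)
Lemma junta_representable B f : junta B f -> representable (size B) (3 ^+ size B) f.
Proof.
elim: B f => [|i B IHB] f [f_B f_1] /=.
  pose c := f [ffun=> false]; exists c%:MP; split=> [||x].
  - by rewrite msizeC; case: eqP.
  - rewrite /coef_abs_sum msuppC; case: eqP => [_|_]; first by rewrite big_nil.
    by rewrite big_seq1 mcoeffC eqxx mulr1 f_1.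
  - by rewrite /mpoly_eval mevalC; apply: f_B.
have fix_B b : representable (size B) (3 ^+ size B) (fun x => f (update x i b)).
  apply: IHB; split=> [x y xy|x]; last exact: f_1.
  apply: f_B => j; rewrite inE !ffunE; case: eqP => //= _; exact: xy.
have f0 := representable_weaken (leqnSn _) (lexx _) (fix_B false).
have f1 := representable_var i (fix_B true).
have f01 := representableZ (-1) (representable_var i (fix_B false)).
have := representableD f0 (representableD f1 f01).
rewrite normrN1 mul1r (_ : _ + _ = 3 ^+ (size B).+1); last by rewrite exprS; ring.
apply: representable_ext => x.
have -> : f x = f (update x i (x i)).
  by congr f; apply/ffunP => j; rewrite ffunE; case: eqP => // ->.
by case: (x i); rewrite ?mulr1 ?mulr0; ring.
Qed.

End CoefNorm.

(** * Chebyshev polynomials of a self-adjoint operator *)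

Section Chebyshev.
Variables (R : realType) (X : finType).
Local Notation V := {ffun X -> R^o}.
Implicit Types (f g h : V) (N : {linear V -> V}).

Definition dot f g : R := \sum_s (f s : R) * (g s : R).

Lemma dotC f g : dot f g = dot g f.
Proof. by apply: eq_bigr => s _; rewrite mulrC. Qed.

Lemma dotDl f g h : dot (f + g) h = dot f h + dot g h.
Proof. by rewrite -big_split /=; apply: eq_bigr => s _; rewrite ffunE mulrDl. Qed.

Lemma dotZl c f g : dot (c *: f) g = c * dot f g.
Proof. by rewrite mulr_sumr; apply: eq_bigr => s _; rewrite ffunE mulrA. Qed.

Lemma dotNl f g : dot (- f) g = - dot f g.
Proof. by rewrite -scaleN1r dotZl mulN1r. Qed.

Lemma dotDr f g h : dot h (f + g) = dot h f + dot h g.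
Proof. by rewrite dotC dotDl !(dotC _ h). Qed.

Lemma dotZr c f g : dot f (c *: g) = c * dot f g.
Proof. by rewrite dotC dotZl dotC. Qed.

Lemma dotNr f g : dot f (- g) = - dot f g.
Proof. by rewrite dotC dotNl dotC. Qed.

Definition dotE := (dotDl, dotDr, dotZl, dotZr, dotNl, dotNr).

Lemma dot_ge0 f : 0 <= dot f f.
Proof. by apply: sumr_ge0 => s _; rewrite -expr2 sqr_ge0. Qed.

Lemma dot_eq0 f : dot f f = 0 -> f = 0.
Proof.
move/eqP; rewrite psumr_eq0 => [/allP f0|s _]; last by rewrite -expr2 sqr_ge0.
apply/ffunP => s; have := f0 s (mem_index_enum s).
by rewrite -expr2 sqrf_eq0 ffunE => /eqP.
Qed.

Lemma cauchy_schwarz f g : dot f g ^+ 2 <= dot f f * dot g g.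
Proof.
have [/dot_eq0 ->|g_neq0] := eqVneq (dot g g) 0.
  by rewrite -(scale0r 0) !dotE !mul0r mulr0 expr0n.
have g_gt0 : 0 < dot g g by rewrite lt_def g_neq0 dot_ge0.
have := dot_ge0 (dot g g *: f - dot f g *: g).
rewrite !dotE (dotC g f) => ge0; rewrite -subr_ge0 -(pmulr_rge0 _ g_gt0).
by apply: le_trans ge0 _; rewrite le_eqVlt; apply/orP; left; apply/eqP; ring.
Qed.

Definition self_adjoint N := forall f g, dot (N f) g = dot f (N g).

(* If 0 <= N <= 1 then both (1 - N) N (1 - N) and N (1 - N) N are
   nonnegative, and their sum is N (1 - N). *)
Lemma psd_contraction N f : self_adjoint N ->
  (forall g, 0 <= dot g (N g)) -> (forall g, dot g (N g) <= dot g g) ->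
  dot (N f) (N f) <= dot f f.
Proof.
move=> N_sa N_ge0 N_le; have fNN : dot f (N (N f)) = dot (N f) (N f) by rewrite N_sa.
have := N_ge0 (f - N f); have := N_le (N f); have := N_le f.
by rewrite linearB /= !dotE fNN; lra.
Qed.

Fixpoint chebyshev N f m : V :=
  if m is m1.+1 then
    if m1 is m2.+1 then 2 *: N (chebyshev N f m1) - chebyshev N f m2 else N f
  else f.

(* Operator form of Pell's equation T^2 + (1 - z^2) U^2 = 1. *)
Lemma chebyshev_contraction N f m : self_adjoint N ->
  (forall g, dot (N g) (N g) <= dot g g) ->
  dot (chebyshev N f m) (chebyshev N f m) <= dot f f.
Proof.
move=> N_sa N_le.
(* The pair runs through [T_m(N) f] and [U_(m-1)(N) f], by [T_(m+1) = z T_m - (1 - z^2) U_(m-1)] and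
   [U_m = z U_(m-1) + T_m], with [U_(-1) = 0]. *)
pose step (p : V * V) := (N p.1 - p.2 + N (N p.2), N p.2 + p.1).
pose TU m := iter m step (f, 0 : V).
have chebE n : chebyshev N f n = (TU n).1 /\ chebyshev N f n.+1 = (TU n.+1).1.
  elim: n => [|n [IHn IHn1]]; first by rewrite /TU /= !linear0 !addr0.
  split=> //; rewrite -/chebyshev [LHS]/= -[N (match _ with _ => _ end)]/(N (chebyshev N f n.+1)).
  rewrite IHn IHn1 /TU !iterS /=; case: (iter n step _) => w v /=.
  rewrite scaler_nat mulr2n !(linearD, linearN) /=.
  by apply/ffunP => s; rewrite !ffunE; ring.
have -> := (chebE m).1.
suff : dot (TU m).1 (TU m).1
       + (dot (TU m).2 (TU m).2 - dot (N (TU m).2) (N (TU m).2)) = dot f f.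
  by move<-; rewrite lerDl subr_ge0.
elim: m {chebE} => [|n <-]; first by rewrite /TU /= linear0 -(scale0r 0) !dotE; ring.
rewrite /TU iterS /=; case: (iter n step _) => w v /=.
rewrite !(linearD, linearN) /= !dotE.
have e1 : dot (N w) v = dot w (N v) by exact: N_sa.
have e2 : dot v (N (N v)) = dot (N v) (N v) by rewrite N_sa.
rewrite (dotC v (N w)) e1 (dotC (N v) w) (dotC (N (N v)) v) e2; lra.
Qed.

(** Both sides obey the same three-term recurrence: this is [cosh] of a multiple argument, with
    [rho] the exponential of the argument. *)
Lemma chebyshev_eigen N f rho m : rho != 0 ->
  N f = ((rho + rho^-1) / 2) *: f ->
  chebyshev N f m = ((rho ^+ m + rho ^- m) / 2) *: f.
Proof.
move=> rho_neq0 Nf.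
suff H n : chebyshev N f n = ((rho ^+ n + rho ^- n) / 2) *: f /\
    chebyshev N f n.+1 = ((rho ^+ n.+1 + rho ^- n.+1) / 2) *: f by have [] := H m.
elim: n => [|n [IHn IHn1]].
  by rewrite /= !expr1 Nf expr0 invr1 (_ : (1 + 1) / 2 = 1) ?scale1r //; field.
split=> //; rewrite [LHS]/= -[N (match _ with _ => _ end)]/(N (chebyshev N f n.+1)).
rewrite IHn IHn1 linearZ /= Nf !scalerA -scalerBl; congr (_ *: _).
by rewrite -!exprVn !exprSr; field.
Qed.

End Chebyshev.

(** * Coordinate resampling and the Efron-Stein inequality *)

Section Resampling.
Variables (R : realType) (I T : finType).
Local Notation X := {ffun I -> T}.
Local Notation V := {ffun X -> R^o}.
Implicit Types (f g h : V) (s t : X) (i j : I) (js : seq I).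

Lemma update_id s i : update s i (s i) = s.
Proof. by apply/ffunP => j; rewrite ffunE; case: eqP => // ->. Qed.

Lemma update_update s i a b : update (update s i a) i b = update s i b.
Proof. by apply/ffunP => j; rewrite !ffunE; case: eqP. Qed.

Lemma updateC s i j a b : i != j ->
  update (update s i a) j b = update (update s j b) i a.
Proof.
move=> i_j; apply/ffunP => t; rewrite !ffunE.
by case: (eqVneq t j) => // ->; rewrite eq_sym (negbTE i_j).
Qed.

Definition resample j f : V :=
  [ffun s => #|T|%:R^-1 * \sum_a (f (update s j a) : R)].

Fact resample_is_linear j : linear (resample j).
Proof.
move=> c f g; apply/ffunP => s; rewrite !ffunE /= [RHS]/(_ + _).
under eq_bigr do rewrite !ffunE.
by rewrite big_split /= mulrDr -mulr_sumr mulrCA.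
Qed.

HB.instance Definition _ j :=
  GRing.isLinear.Build R V V _ (resample j) (resample_is_linear j).

Lemma resample_self_adjoint j : self_adjoint (resample j).
Proof.
move=> f g; rewrite /dot.
under eq_bigr do rewrite ffunE -mulrA mulr_suml.
under [RHS]eq_bigr do rewrite ffunE mulrCA mulr_sumr.
rewrite -!mulr_sumr; congr (_ * _); rewrite !pair_big /=.
(* Exchanging the old letter at [j] with the fresh one permutes the pairs (word, fresh letter) and
   exchanges the roles of [f] and [g]. *)
pose swap (p : X * T) := (update p.1 j p.2, p.1 j).
have swapK : involutive swap.
  by case=> s a; rewrite /swap /= update_update update_id ffunE eqxx.
rewrite (reindex_inj (inv_inj swapK)) /=; apply: eq_bigr => -[s a] _ /=.
by rewrite update_update update_id.
Qed.

Lemma resampleC i j f : resample i (resample j f) = resample j (resample i f).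
Proof.
have [->//|i_j] := eqVneq i j; apply/ffunP => s; rewrite !ffunE.
under eq_bigr do rewrite ffunE.
under [in RHS]eq_bigr do rewrite ffunE.
rewrite -!mulr_sumr exchange_big /=; congr (_ * (_ * _)).
by apply: eq_bigr => a _; apply: eq_bigr => b _; rewrite updateC.
Qed.

Hypothesis T_gt0 : (0 < #|T|)%N.

Let T_neq0 : #|T|%:R != 0 :> R.
Proof. by rewrite pnatr_eq0 -lt0n. Qed.

Lemma resampleK j f : resample j (resample j f) = resample j f.
Proof.
apply/ffunP => s; rewrite ffunE [RHS]ffunE.
under eq_bigr do rewrite ffunE; under eq_bigr do under eq_bigr do rewrite update_update.
by rewrite sumr_const -[X in _ * X]mulr_natl mulVKf.
Qed.

Lemma resample_const j (c : R) : resample j [ffun=> c] = [ffun=> c].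
Proof.
apply/ffunP => s; rewrite !ffunE; under eq_bigr do rewrite ffunE.
by rewrite sumr_const -[X in _ * X]mulr_natl mulKf.
Qed.

Lemma dot_resample j f : dot f (resample j f) = dot (resample j f) (resample j f).
Proof. by rewrite resample_self_adjoint /= resampleK. Qed.

(** Pythagoras: [resample j] is idempotent and self-adjoint, hence an orthogonal projection. *)
Lemma resample_residual j f :
  dot (f - resample j f) (f - resample j f) =
  dot f f - dot (resample j f) (resample j f).
Proof. by rewrite !dotE (dotC (resample j f) f) dot_resample; lra. Qed.

Lemma resample_contraction j f : dot (resample j f) (resample j f) <= dot f f.
Proof. by rewrite -subr_ge0 -resample_residual dot_ge0. Qed.

Definition resample_all js f := foldr resample f js.

Lemma resample_allB js f g :
  resample_all js (f - g) = resample_all js f - resample_all js g.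
Proof. by elim: js => //= j js ->; rewrite linearB. Qed.

Lemma resample_allC js j f :
  resample j (resample_all js f) = resample_all js (resample j f).
Proof. by elim: js => //= i js <-; rewrite resampleC. Qed.

Lemma resample_all_contraction js f :
  dot (resample_all js f) (resample_all js f) <= dot f f.
Proof.
elim: js => //= j js; apply: le_trans; exact: resample_contraction.
Qed.

Lemma resample_all_fixed js j f :
  j \in js -> resample j (resample_all js f) = resample_all js f.
Proof.
elim: js => //= i js IHjs; rewrite inE => /predU1P[->|/IHjs j_js].
  by rewrite resampleK.
by rewrite resampleC j_js.
Qed.

Lemma sum_resample_all js f :
  \sum_s (resample_all js f s : R) = \sum_s (f s : R).
Proof.
have dot1 g : \sum_s (g s : R) = dot [ffun=> 1] g.
  by apply: eq_bigr => s _; rewrite ffunE mul1r.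
elim: js => //= j js <-.
by rewrite !dot1 -resample_self_adjoint /= resample_const.
Qed.

(** The left side telescopes over [js]. Each projection commutes with the others, which are
    contractions, so its loss on the already averaged function is at most its loss on [f]. *)
Lemma efron_stein_seq js f :
  dot f f - dot (resample_all js f) (resample_all js f) <=
  \sum_(j <- js) (dot f f - dot (resample j f) (resample j f)).
Proof.
elim: js => [|j js IHjs] /=; first by rewrite big_nil subrr.
rewrite big_cons; set g := resample_all js f.
have : dot g g - dot (resample j g) (resample j g) <=
    dot f f - dot (resample j f) (resample j f).
  rewrite -!resample_residual /g resample_allC -resample_allB.
  exact: resample_all_contraction.
move: IHjs; rewrite -/g; lra.
Qed.

Lemma fixed_const f : (forall j, resample j f = f) -> forall s t, f s = f t.
Proof.
move=> f_fix s t.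
have f_upd u j a : f (update u j a) = f u.
  rewrite -(f_fix j) !ffunE; congr (_ * _).
  by apply: eq_bigr => b _; rewrite update_update.
(* Hybrid words turn [t] into [s] one letter at a time, and no single change alters [f]. *)
pose mix js : X := [ffun i => if i \in js then s i else t i].
have mixE js : f (mix js) = f t.
  elim: js => [|j js IHjs].
    by have -> : mix [::] = t by apply/ffunP => i; rewrite ffunE.
  rewrite -IHjs -(f_upd (mix js) j (s j)).
  suff -> : mix (j :: js) = update (mix js) j (s j) by [].
  by apply/ffunP => i; rewrite !ffunE inE; case: eqVneq => [->|].
rewrite -(mixE (enum I)); suff -> : mix (enum I) = s by [].
by apply/ffunP => i; rewrite ffunE mem_enum.
Qed.

(** Resampling every coordinate leaves the constant mean of [f], whose squared norm is the
    subtracted term. *)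
Lemma efron_stein f :
  dot f f - (\sum_s (f s : R)) ^+ 2 / #|X|%:R <=
  \sum_j (dot f f - dot (resample j f) (resample j f)).
Proof.
set g := resample_all (index_enum I) f.
suff -> : (\sum_s (f s : R)) ^+ 2 / #|X|%:R = dot g g by exact: efron_stein_seq.
have [a _] : exists a, a \in T by exact/card_gt0P.
have X_neq0 : #|X|%:R != 0 :> R.
  rewrite pnatr_eq0 -lt0n; apply/card_gt0P; by exists [ffun=> a].
have gE s : g s = g [ffun=> a].
  by apply: fixed_const => j; apply: resample_all_fixed; rewrite mem_index_enum.
rewrite -(sum_resample_all (index_enum I)) -/g /dot.
under eq_bigr do rewrite gE; under [RHS]eq_bigr do rewrite gE.
by rewrite !sumr_const -[RHS]mulr_natl -[X in (X ^+ 2)]mulr_natl; field.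
Qed.

End Resampling.

(** * The killed walk and its spectral gap *)

Section KilledWalk.
Variables (R : realType) (I T : finType).
Hypotheses (I_gt0 : (0 < #|I|)%N) (T_gt0 : (0 < #|T|)%N).
Local Notation X := {ffun I -> T}.
Local Notation V := {ffun X -> R^o}.
Implicit Types (f g : V) (D : pred X).

Definition mask D f : V := [ffun s => (D s)%:R * (f s : R)].

Definition walk f : V := #|I|%:R^-1 *: \sum_j resample j f.

(** [D] holds the surviving words. Masking on both sides keeps the operator self-adjoint and
    positive semidefinite when [c] is positive. *)
Definition killed_walk D (c : R) f : V := c^-1 *: mask D (walk (mask D f)).

Lemma mask_linear D a f g : mask D (a *: f + g) = a *: mask D f + mask D g.
Proof.
apply/ffunP => s; rewrite !ffunE /= [X in _ * X]/(a * f s + g s) mulrDr.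
by rewrite mulrCA.
Qed.

Lemma walk_linear a f g : walk (a *: f + g) = a *: walk f + walk g.
Proof.
rewrite /walk; under eq_bigr do rewrite linearP.
by rewrite big_split -scaler_sumr /= scalerDr !scalerA mulrC.
Qed.

Fact killed_walk_is_linear D c : linear (killed_walk D c).
Proof.
move=> a f g; rewrite /killed_walk mask_linear walk_linear mask_linear scalerDr !scalerA.
by rewrite mulrC.
Qed.

HB.instance Definition _ D c :=
  GRing.isLinear.Build R V V _ (killed_walk D c) (killed_walk_is_linear D c).

Lemma dot_mask D f g : dot (mask D f) g = dot f (mask D g).
Proof. by apply: eq_bigr => s _; rewrite !ffunE mulrCA mulrA. Qed.

Lemma mask_contraction D f : dot (mask D f) (mask D f) <= dot f f.
Proof.
apply: ler_sum => s _; rewrite ffunE; case: (D s).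
  by rewrite mul1r.
by rewrite mul0r mulr0 -expr2 sqr_ge0.
Qed.

Lemma dot_suml (J : finType) (F : J -> V) g : dot (\sum_j F j) g = \sum_j dot (F j) g.
Proof.
rewrite /dot exchange_big /=; apply: eq_bigr => s _.
by rewrite -mulr_suml sum_ffunE.
Qed.

Lemma dot_walkl f g : dot (walk f) g = #|I|%:R^-1 * \sum_j dot (resample j f) g.
Proof. by rewrite dotZl dot_suml. Qed.

Lemma walk_self_adjoint f g : dot (walk f) g = dot f (walk g).
Proof.
rewrite dot_walkl [RHS]dotC dot_walkl; congr (_ * _); apply: eq_bigr => j _.
by rewrite [RHS]dotC; exact: resample_self_adjoint.
Qed.

Lemma dot_walk f :
  dot f (walk f) = #|I|%:R^-1 * \sum_j dot (resample j f) (resample j f).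
Proof.
rewrite dotC dot_walkl; congr (_ * _); apply: eq_bigr => j _.
by rewrite dotC; exact: dot_resample.
Qed.

(** Cauchy-Schwarz against the indicator of [D], whose squared norm is at most
    [(1 - delta) #|X|]. *)
Lemma sum_mask_le D delta f :
  delta * #|X|%:R <= #|[pred s | ~~ D s]|%:R ->
  (\sum_s (mask D f s : R)) ^+ 2 / #|X|%:R <=
  (1 - delta) * dot (mask D f) (mask D f).
Proof.
move=> delta_le; have X_gt0 : 0 < #|X|%:R :> R.
  have [a _] : exists a, a \in T by exact/card_gt0P.
  by rewrite ltr0n; apply/card_gt0P; exists [ffun=> a].
pose u : V := [ffun s => (D s)%:R].
have -> : \sum_s (mask D f s : R) = dot u (mask D f).
  by apply: eq_bigr => s _; rewrite !ffunE mulrA -natrM mulnb andbb.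
rewrite ler_pdivrMr // (le_trans (cauchy_schwarz _ _)) // mulrAC.
rewrite ler_wpM2r ?dot_ge0 //.
have -> : dot u u = #|X|%:R - #|[pred s | ~~ D s]|%:R.
  rewrite -(cardC D) natrD addrK /dot.
  under eq_bigr do rewrite ffunE -natrM mulnb andbb.
  rewrite -natr_sum -sum1_card [in RHS]big_mkcond; congr (_%:R).
by rewrite mulrBl mul1r lerB.
Qed.

(** For masked [u], [sum_mask_le] and Efron-Stein give a total loss of at least [delta |u|^2] over
    the coordinates. Averaging, [<u, walk u> <= (1 - delta / #|I|) |u|^2 <= c |u|^2], and
    [psd_contraction] applies. *)
Lemma killed_walk_contraction D c delta f : 0 < c ->
  delta * #|X|%:R <= #|[pred s | ~~ D s]|%:R -> 1 - delta / #|I|%:R <= c ->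
  dot (killed_walk D c f) (killed_walk D c f) <= dot f f.
Proof.
move=> c_gt0 delta_le c_ge; have I_gt0R : 0 < #|I|%:R :> R by rewrite ltr0n.
have dotN g : dot g (killed_walk D c g) = c^-1 * dot (mask D g) (walk (mask D g)).
  by rewrite dotZr dot_mask.
apply: psd_contraction => [g h|g|g] /=.
- by rewrite !(dotZl, dotZr) dot_mask walk_self_adjoint dot_mask.
- rewrite dotN mulr_ge0 ?invr_ge0 ?(ltW c_gt0) // dot_walk.
  rewrite mulr_ge0 ?invr_ge0 ?ler0n // sumr_ge0 // => j _; exact: dot_ge0.
rewrite dotN ler_pdivrMl //; set u := mask D g.
apply: le_trans (_ : c * dot u u <= _); last first.
  by rewrite ler_pM2l // mask_contraction.
apply: le_trans (_ : (1 - delta / #|I|%:R) * dot u u <= _); last first.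
  by rewrite ler_wpM2r ?dot_ge0.
have := sum_mask_le g delta_le; have := efron_stein T_gt0 u; rewrite -/u.
rewrite sumrB sumr_const -[dot u u *+ _]mulr_natl dot_walk ler_pdivrMl //.
set S := \sum_j _; set t := _ / _ => le1 le2.
have -> : #|I|%:R * ((1 - delta / #|I|%:R) * dot u u) = (#|I|%:R - delta) * dot u u.
  by field; rewrite gt_eqF.
by lra.
Qed.

Lemma killed_walk_const D c a : (forall s, D s) ->
  killed_walk D c [ffun=> a] = c^-1 *: [ffun=> a].
Proof.
move=> D1; have mask_id f : mask D f = f.
  by apply/ffunP => s; rewrite ffunE D1 mul1r.
rewrite /killed_walk !mask_id /walk.
under eq_bigr do rewrite resample_const //.
rewrite sumr_const -scaler_nat !scalerA -mulrA mulVf ?mulr1 //.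
by rewrite pnatr_eq0 -lt0n.
Qed.

End KilledWalk.

(** * Degree and coefficient growth along the walk *)

Section Representation.
Variables (R : realType) (I : finType) (l : nat).
Hypotheses (I_gt0 : (0 < #|I|)%N) (l_gt0 : (0 < l)%N).
Local Notation X := {ffun I -> 'I_l}.
Local Notation V := {ffun X -> R^o}.
Variables (D : cube l -> pred X) (c : R).
Hypotheses (c_ge : 1 / 2 <= c).
Hypothesis D_junta : forall s : X, junta (codom s) (fun x => (D x s)%:R : R).

Lemma killed_walkE (P : pred X) (f : V) s : killed_walk P c f s =
  c^-1 * (#|I|%:R^-1 * \sum_j (#|'I_l|%:R^-1 * \sum_a
    ((P s)%:R * (P (update s j a))%:R * f (update s j a)))).
Proof.
rewrite !ffunE sum_ffunE /GRing.scale /=; congr (_ * _).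
rewrite mulrCA mulr_sumr.
congr (_ * _); apply: eq_bigr => j _; rewrite ffunE mulrCA mulr_sumr.
by congr (_ * _); apply: eq_bigr => a _; rewrite ffunE mulrA.
Qed.

(* The bound allows an arbitrary junta factor f on a list B containing s, so
   that one step of the walk only appends the new coordinate to B. *)
Definition walk_representable (e : nat) (K : R) (v : cube l -> V) :=
  forall B (s : X) f, {subset codom s <= B} -> junta B f ->
  representable (size B + e) (3 ^+ size B * K) (fun x => f x * v x s).

(** The factor 6 is 3 for the coordinate appended to [B] times 2 for [c^-1 <= 2]. Both survival
    indicators join the junta factor. *)
Lemma walk_representable_step e K v : 0 <= K -> walk_representable e K v ->
  walk_representable e.+1 (6 * K) (fun x => killed_walk (D x) c (v x)).
Proof.
move=> K_ge0 vK B s f s_B f_B.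
pose F j a x := f x * (D x s)%:R * (D x (update s j a))%:R * v x (update s j a).
have Frep j a : representable (size B + e.+1) (3 ^+ size B * (3 * K)) (F j a).
  have sub_aB : {subset codom (update s j a) <= a :: B}.
    move=> i /codomP[j' ->]; rewrite ffunE inE.
    by case: (j' == j); rewrite ?eqxx // s_B ?codom_f ?orbT.
  have subB : {subset B <= a :: B} by move=> i i_B; rewrite inE i_B orbT.
  apply: representable_weaken (vK (a :: B) _ _ sub_aB _); rewrite /= ?addSnnS //.
    by rewrite exprS mulrCA mulrA.
  apply: juntaM; last exact: junta_subset sub_aB (D_junta _).
  apply: junta_subset subB _; apply: juntaM => //.
  exact: junta_subset s_B (D_junta _).
have l_card : (0 < #|'I_l|)%N by rewrite card_ord.
have := representableZ c^-1
  (representable_mean I_gt0 (fun j => representable_mean l_card (Frep j))).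
move/representable_weaken => /(_ _ _ (leqnn _) (_ : _ <= 3 ^+ size B * (6 * K))) rep.
apply: representable_ext (rep _) => [x|].
  apply/esym; rewrite killed_walkE mulrCA; congr (_ * _); rewrite mulrCA mulr_sumr.
  congr (_ * _); apply: eq_bigr => j _; rewrite mulrCA mulr_sumr.
  by congr (_ * _); apply: eq_bigr => a _; rewrite /F !mulrA.
have c_gt0 : 0 < c by apply: lt_le_trans c_ge; rewrite divr_gt0.
rewrite gtr0_norm ?invr_gt0 // mulrCA ler_wpM2l ?exprn_ge0 //.
rewrite ler_pdivrMl // (le_trans _ (ler_wpM2r _ c_ge)) ?mulr_ge0 //; lra.
Qed.

(** The recurrence turns bounds [K_m] into [2 * 6 * K_(m+1) + K_m], and [12 * 13 + 1 <= 13 ^ 2]. *)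
Lemma chebyshev_representable m :
  walk_representable m (13 ^+ m)
    (fun x => chebyshev (killed_walk (D x) c) [ffun=> 1] m).
Proof.
pose v m x := chebyshev (killed_walk (D x) c) [ffun=> 1] m.
rewrite -/(v m); suff [] : walk_representable m (13 ^+ m) (v m) /\
   walk_representable m.+1 (13 ^+ m.+1) (v m.+1) by [].
have v0 : walk_representable 0 1 (v 0).
  move=> B s f s_B f_B; rewrite addn0 mulr1.
  by apply: representable_ext (junta_representable f_B) => x; rewrite ffunE mulr1.
elim: m => [|m [IHm IHm1]].
  split=> // B s f s_B f_B; apply: representable_weaken (leqnn _) _ _; last first.
    exact: (walk_representable_step ler01 v0 s_B f_B).
  by rewrite ler_wpM2l ?exprn_ge0 // expr1; lra.
split=> // B s f s_B f_B.
have rep1 := walk_representable_step (exprn_ge0 m.+1 (ler0n R 13)) IHm1 s_B f_B.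
have rep0 := representableZ (-1) (IHm B s f s_B f_B).
have le_size : (size B + m <= size B + m.+2)%N by rewrite leq_add2l ltnW.
have := representableD (representableZ 2 rep1)
  (representable_weaken le_size (lexx _) rep0).
move/representable_weaken => /(_ _ (3 ^+ size B * 13 ^+ m.+2) (leqnn _)) rep.
apply: representable_ext (rep _) => [x|].
  rewrite [v m.+2 x]/v /= !ffunE -/(v m.+1 x) -/(v m x).
  by rewrite [X in _ = _ * X]/(2 * _ - _) mulrBr mulN1r mulrCA.
rewrite normrN1 mul1r ger0_norm // mulrCA -mulrDr ler_wpM2l ?exprn_ge0 //.
have := exprn_ge0 m (ler0n R 13); rewrite !exprS; lra.
Qed.

End Representation.

(** * Counting words that contain a given set of letters *)

Section Hitting.
Variables (I T : finType).

(* Placing an injective sequence v of k letters at the positions p in a word t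
   avoiding v erases k letters of t; recording them makes the map injective. *)
Lemma card_hitting (V : {set T}) :
  (#|I| ^_ #|V| * (#|T| - #|V|) ^ #|I| <=
   #|[set s : {ffun I -> T} | V \subset codom s]| * #|T| ^ #|V|)%N.
Proof.
set k := #|V|; pose v (i : 'I_k) : T := enum_val i.
have v_inj : injective v by exact: enum_val_inj.
have v_V i : v i \in V by exact: enum_valP.
pose place (pt : {ffun 'I_k -> I} * {ffun I -> T}) : {ffun I -> T} * {ffun 'I_k -> T} :=
  ([ffun j => if [pick i | pt.1 i == j] is Some i then v i else pt.2 j],
   [ffun i => pt.2 (pt.1 i)]).
pose A := setX [set p : {ffun 'I_k -> I} | injectiveb p]
               [set t : {ffun I -> T} | t \in ffun_on (mem (~: V))].
have place_p (p : {ffun 'I_k -> I}) (t : {ffun I -> T}) i : injective p -> (place (p, t)).1 (p i) = v i.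
  move=> p_inj; rewrite ffunE /=; case: pickP => [i' /eqP/p_inj -> //|].
  by move/(_ i); rewrite eqxx.
have place_np (p : {ffun 'I_k -> I}) (t : {ffun I -> T}) j : j \notin codom p -> (place (p, t)).1 j = t j.
  rewrite ffunE /=; case: pickP => // i /eqP <-; by rewrite codom_f.
have place_inj : {in A &, injective place}.
  move=> [p t] [p' t']; rewrite !inE /=.
  move=> /andP[/injectiveP p_inj /ffun_onP t_V] /andP[/injectiveP p'_inj /ffun_onP t'_V] eq_pl.
  (* Position [p i] shows the letter [v i] of [V], which [t'] avoids; so it was placed by [p'], and
     the letter identifies the index. *)
  have eq_p : p = p'.
    apply/ffunP => i; have := place_p p t i p_inj; rewrite eq_pl.
    have [/codomP[i' ->]|ni] := boolP (p i \in codom p').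
      by rewrite place_p // => /v_inj ->.
    rewrite place_np // => t'v; have := t'_V (p i).
    by rewrite t'v inE v_V.
  rewrite -eq_p in eq_pl *; congr (_, _); apply/ffunP => j.
  have [/codomP[i ->]|nj] := boolP (j \in codom p).
    by have := congr1 (fun st : {ffun I -> T} * {ffun 'I_k -> T} => st.2 i) eq_pl; rewrite !ffunE.
  by rewrite -(place_np p t j nj) eq_pl place_np.
have -> : (#|I| ^_ k * (#|T| - k) ^ #|I|)%N = #|A|.
  rewrite cardsX card_inj_ffuns card_ord; congr (_ * _)%N.
  by rewrite cardsE card_ffun_on; congr (_ ^ _)%N; rewrite -(cardsC V) addKn.
rewrite -(card_in_imset place_inj).
have -> : (#|T| ^ k = #|[set: {ffun 'I_k -> T}]|)%N.
  by rewrite cardsT card_ffun card_ord.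
rewrite -cardsX; apply/subset_leq_card/subsetP => _ /imsetP[[p t] + ->].
rewrite !inE /= => /andP[/injectiveP p_inj _]; rewrite andbT.
apply/subsetP => a a_V; pose i := enum_rank_in a_V a.
have <- : v i = a by exact: enum_rankK_in.
by rewrite -(place_p p t i p_inj) codom_f.
Qed.

End Hitting.

(** * Lower bound on the density of such words *)

Section HittingDensity.
Variable R : realType.

Lemma ffact_ge (n k : nat) : (2 * k <= n)%N -> (n%:R / 2) ^+ k <= (n ^_ k)%:R :> R.
Proof.
elim: k => [|k IHk] le_n; first by rewrite expr0 ffactn0.
have le_kn : (k <= n)%N by lia.
rewrite ffactnSr natrM exprSr ler_pM ?exprn_ge0 ?divr_ge0 ?ler0n ?IHk //; first by lia.
rewrite natrB // ler_pdivrMr //.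
have : (2 * k)%:R <= n%:R :> R by rewrite ler_nat; lia.
by rewrite natrM; lra.
Qed.

(** Fourth power of [e^(1/2) <= 2], which comes from [e^(-1/2) >= 1 - 1/2]. *)
Lemma expR2_le16 : expR 2 <= 16 :> R.
Proof.
have -> : 2 = 4%:R * 2^-1 :> R by field.
rewrite expRM_natl (_ : 16 = 2 ^+ 4); last by ring.
rewrite ler_pXn2r // ?nnegrE ?expR_ge0 //.
rewrite -[expR _]invrK -[leRHS]invrK lef_pV2 ?posrE ?invr_gt0 ?expR_gt0 //.
rewrite -expRN; apply: le_trans (expR_ge1Dx _); lra.
Qed.

(** For [k <= n / 2] one has [n / (n - k) <= 1 + 2k/n <= e^(2k/n)], and [r <= n] such factors give
    at most [e^(2k)]. *)
Lemma exprn_drop (n k r : nat) : (0 < n)%N -> (2 * k <= n)%N -> (r <= n)%N ->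
  n%:R ^+ r <= 16 ^+ k * (n - k)%:R ^+ r :> R.
Proof.
move=> n_gt0 le_kn le_rn; have n_gt0R : 0 < n%:R :> R by rewrite ltr0n.
have le_kn' : (k <= n)%N by lia.
have kR : 2 * k%:R <= n%:R :> R by rewrite -natrM ler_nat.
have step : n%:R <= expR (2 * k%:R / n%:R) * (n - k)%:R :> R.
  apply: le_trans (_ : (1 + 2 * k%:R / n%:R) * (n - k)%:R <= _); last first.
    by rewrite ler_wpM2r ?expR_ge1Dx.
  rewrite natrB // -(ler_pM2r n_gt0R).
  have -> : (1 + 2 * k%:R / n%:R) * (n%:R - k%:R) * n%:R =
    (n%:R + 2 * k%:R) * (n%:R - k%:R) :> R by field; rewrite gt_eqF.
  have : 0 <= k%:R * (n%:R - 2 * k%:R) :> R by rewrite mulr_ge0 // subr_ge0.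
  nra.
apply: le_trans (_ : (expR (2 * k%:R / n%:R) * (n - k)%:R) ^+ r <= _).
  by apply: lerXn2r => //; rewrite nnegrE ?mulr_ge0 ?expR_ge0.
rewrite exprMn ler_wpM2r ?exprn_ge0 // -expRM_natl.
apply: le_trans (_ : expR (k%:R * 2) <= _); last first.
  rewrite expRM_natl; apply: lerXn2r expR2_le16; by rewrite nnegrE ?expR_ge0.
rewrite ler_expR mulrA ler_pdivrMr // [leRHS]mulrC (mulrC k%:R).
by rewrite ler_wpM2r ?mulr_ge0 ?ler_nat.
Qed.

(** In 32, a factor 2 per letter comes from the falling factorial and 16 from avoiding [V] in the
    rest of the word. The base is at most 1, so the exponent [#|V|] may be raised to [k]. *)
Lemma hitting_density (r l k : nat) (V : {set 'I_l}) :
  (0 < l)%N -> (2 * k <= r)%N -> (r <= l)%N -> (#|V| <= k)%N ->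
  (r%:R / (32 * l%:R)) ^+ k * #|{ffun 'I_r -> 'I_l}|%:R <=
  #|[set s : {ffun 'I_r -> 'I_l} | V \subset codom s]|%:R :> R.
Proof.
move=> l_gt0 le_kr le_rl; set v := #|V| => le_vk.
have l_gt0R : 0 < l%:R :> R by rewrite ltr0n.
have rl : r%:R <= l%:R :> R by rewrite ler_nat.
apply: le_trans (_ : (r%:R / (32 * l%:R)) ^+ v * #|{ffun 'I_r -> 'I_l}|%:R <= _).
  rewrite ler_wpM2r ?ler0n // ler_wiXn2l // ?divr_ge0 ?mulr_ge0 //.
  by rewrite ler_pdivrMr ?mulr_gt0 //; lra.
have hit : ((r ^_ v)%:R * (l - v)%:R ^+ r <=
    #|[set s : {ffun 'I_r -> 'I_l} | V \subset codom s]|%:R * l%:R ^+ v :> R).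
  by rewrite -!natrX -!natrM ler_nat; have := card_hitting 'I_r V; rewrite !card_ord.
rewrite -(ler_pM2r (exprn_gt0 v l_gt0R)); apply: le_trans hit.
rewrite card_ffun !card_ord natrX.
have -> : (r%:R / (32 * l%:R)) ^+ v * l%:R ^+ r * l%:R ^+ v =
    (r%:R / 2) ^+ v * (l%:R ^+ r / 16 ^+ v) :> R.
  rewrite mulrAC -exprMn (_ : _ / _ * _ = r%:R / 2 * 16^-1); last first.
    by field; rewrite gt_eqF.
  by rewrite exprMn exprVn; ring.
apply: ler_pM; rewrite ?divr_ge0 ?exprn_ge0 ?divr_ge0 ?ler0n //.
  by apply: ffact_ge; lia.
rewrite ler_pdivrMr ?exprn_gt0 // mulrC; apply: exprn_drop => //; lia.
Qed.

End HittingDensity.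

(** * The approximating polynomial for given walk parameters *)

Section Approximant.
Variables (R : realType) (l k : nat) (phi : cnf l).
Hypotheses (l_gt0 : (0 < l)%N)
  (phi_width : all (fun c => clause_width c <= k)%N phi).

Definition clause_vars (c : clause l) : {set 'I_l} := [set i in map fst c].

Definition unmarked (r : nat) (x : cube l) (s : {ffun 'I_r -> 'I_l}) : bool :=
  all (fun c => (clause_vars c \subset codom s) ==> clause_eval x c) phi.

(** A clause matters only when all its variables are letters of [s]. *)
Lemma unmarked_junta r (s : {ffun 'I_r -> 'I_l}) :
  junta (codom s) (fun x => (unmarked x s)%:R : R).
Proof.
split=> [x y xy|x]; last by rewrite ger0_norm ?ler0n // lern1 leq_b1.
congr (nat_of_bool _)%:R; apply: eq_in_all => c _.
case: (boolP (_ \subset _)) => //= /subsetP sub_c.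
apply: eq_in_has => u u_c; rewrite /literal_eval xy //.
by apply: sub_c; rewrite inE map_f.
Qed.

Lemma unmarked_true r x (s : {ffun 'I_r -> 'I_l}) :
  cnf_eval x phi -> unmarked x s.
Proof. by move/allP => x_phi; apply/allP => c /x_phi ->; rewrite implybT. Qed.

(** One falsified clause suffices: it marks every word that covers its at most [k] variables. *)
Lemma marked_density r x : (2 * k <= r)%N -> (r <= l)%N -> ~~ cnf_eval x phi ->
  (r%:R / (32 * l%:R)) ^+ k * #|{ffun 'I_r -> 'I_l}|%:R <=
  #|[pred s : {ffun 'I_r -> 'I_l} | ~~ unmarked x s]|%:R :> R.
Proof.
move=> le_kr le_rl /allPn[c c_phi x_c].
have c_k : (#|clause_vars c| <= k)%N.
  apply: leq_trans (allP phi_width _ c_phi); rewrite /clause_width -(size_map fst).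
  by rewrite cardsE card_size.
apply: le_trans (hitting_density R l_gt0 le_kr le_rl c_k) _.
rewrite ler_nat; apply/subset_leq_card/subsetP => s; rewrite !inE => c_s.
by apply/allPn; exists c => //; rewrite c_s.
Qed.

Lemma approximant (r m : nat) (h eps : R) :
  (0 < r)%N -> (2 * k <= r)%N -> (r <= l)%N -> 0 < h -> h <= 1 ->
  h ^+ 2 <= (r%:R / (32 * l%:R)) ^+ k / r%:R ->
  0 < eps -> 2 / eps <= (1 + h) ^+ m ->
  exists q : {mpoly R[l]},
    [/\ (msize q <= (r + m).+1)%N, coef_abs_sum q <= 3 ^+ r * 13 ^+ m,
        forall x, cnf_eval x phi -> mpoly_eval q x = 1
      & forall x, ~~ cnf_eval x phi -> `|mpoly_eval q x| <= eps].
Proof.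
move=> r_gt0 le_kr le_rl h_gt0 h_le1 h_delta eps_gt0 le_m.
set delta := (_ / _) ^+ k in h_delta.
(* With [1/c] in this form, [T_m(1/c)] is the explicit number [tau], and [1 <= z <= 1 + h^2] puts
   [c] above both [1/2] and [1 - delta / r]. *)
pose rho := 1 + h; pose z := (rho + rho^-1) / 2; pose c := z^-1.
pose tau := (rho ^+ m + rho ^- m) / 2.
have rho_gt1 : 1 < rho by rewrite ltrDl.
have rho_gt0 : 0 < rho by exact: lt_trans rho_gt1.
have rho_neq0 : rho != 0 by rewrite gt_eqF.
have zE : z = 1 + h ^+ 2 / (2 * rho) by rewrite /z /rho; field; rewrite -/rho.
have hrho_ge0 : 0 <= h ^+ 2 / (2 * rho).
  by rewrite divr_ge0 ?sqr_ge0 // mulr_ge0 // ltW.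
have z_gt0 : 0 < z by rewrite zE ltr_wpDr.
have h2_le1 : h ^+ 2 <= 1 by rewrite expr_le1 // ltW.
have hrho_le : h ^+ 2 / (2 * rho) <= h ^+ 2.
  rewrite ler_pdivrMr ?mulr_gt0 // ler_peMr ?sqr_ge0 //; lra.
have c_gt0 : 0 < c by rewrite invr_gt0.
have c_ge : 1 / 2 <= c by rewrite /c div1r lef_pV2 ?posrE // zE; lra.
have c_gap : 1 - delta / r%:R <= c.
  apply: le_trans (_ : 1 - h ^+ 2 <= _); first by rewrite lerB.
  rewrite /c -[leRHS]mul1r ler_pdivlMr // zE.
  have := mulr_ge0 (sqr_ge0 h) hrho_ge0; lra.
have powm_gt0 : 0 < rho ^+ m by rewrite exprn_gt0.
have tau_ge1 : 1 <= tau.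
  rewrite /tau ler_pdivlMr // mul1r -subr_ge0.
  have -> : rho ^+ m + rho ^- m - 2 = (rho ^+ m - 1) ^+ 2 / rho ^+ m.
    by field; rewrite gt_eqF.
  by rewrite divr_ge0 ?sqr_ge0 // ltW.
have tau_gt0 : 0 < tau by exact: lt_le_trans tau_ge1.
have tau_eps : tau^-1 <= eps.
  rewrite -[eps]invrK lef_pV2 ?posrE ?invr_gt0 // /tau ler_pdivlMr // mulrC.
  apply: le_trans le_m _; by rewrite lerDl invr_ge0 ltW.
have I_gt0 : (0 < #|'I_r|)%N by rewrite card_ord.
have T_gt0 : (0 < #|'I_l|)%N by rewrite card_ord.
pose X := {ffun 'I_r -> 'I_l}.
have X_gt0 : (0 < #|X|)%N by rewrite card_ffun expn_gt0 T_gt0.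
have X_neq0 : #|X|%:R != 0 :> R by rewrite pnatr_eq0 -lt0n.
pose w x := chebyshev (killed_walk (@unmarked r x) c) ([ffun=> 1] : {ffun X -> R^o}) m.
have w_rep (s : X) : representable (r + m) (3 ^+ r * 13 ^+ m) (fun x => w x s).
  have one_junta : junta (codom s) (fun=> 1 : R) by split=> // x; rewrite normr1.
  have := chebyshev_representable I_gt0 l_gt0 c_ge
    (@unmarked_junta r) m (fun=> id) one_junta.
  rewrite size_codom card_ord; apply: representable_ext => x.
  by rewrite mul1r.
have [q [q_size q_norm qE]] :=
  representableZ tau^-1 (representable_mean X_gt0 w_rep).
exists q; split=> // [|x x_phi|x x_phi].
- apply: le_trans q_norm _; rewrite ger0_norm ?invr_ge0 ?(ltW tau_gt0) //.
  by rewrite ler_piMl ?mulr_ge0 ?exprn_ge0 // invf_le1.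
(* Nothing is killed, so the constant 1 is an eigenvector for [z], and dividing by [tau] gives
   exactly 1. *)
- have wE s : w x s = tau.
    have /ffunP/(_ s) : w x = tau *: [ffun=> 1].
      apply: chebyshev_eigen => //=; rewrite killed_walk_const -/z ?invrK //.
      by move=> t; exact: unmarked_true.
    by rewrite !ffunE => ->; rewrite [LHS]mulr1.
  rewrite qE; under eq_bigr do rewrite wE.
  rewrite sumr_const -[X in _ * (_ * X)]mulr_natl mulKf ?mulVf //.
  by rewrite gt_eqF.
rewrite qE normrM ger0_norm ?invr_ge0 ?(ltW tau_gt0) //.
apply: le_trans tau_eps; rewrite ler_piMr ?invr_ge0 ?(ltW tau_gt0) //.
rewrite normrM ger0_norm ?invr_ge0 // ler_pdivrMl ?ltr0n // mulr1.
pose one : {ffun X -> R^o} := [ffun=> 1].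
have one_dot : dot one one = #|X|%:R.
  by rewrite /dot; under eq_bigr do rewrite ffunE mulr1; rewrite sumr_const.
have -> : \sum_s (w x s : R) = dot one (w x).
  by apply: eq_bigr => s _; rewrite ffunE mul1r.
(* Cauchy-Schwarz and the contraction of [T_m(N)] give [<1, w>^2 <= |1|^4 = #|X|^2]. *)
rewrite -ler_sqr ?nnegrE // real_normK ?num_real //.
apply: le_trans (cauchy_schwarz _ _) _; rewrite one_dot expr2 ler_wpM2l //.
rewrite -one_dot; apply: chebyshev_contraction => [f f'|f] /=.
  by rewrite !(dotZl, dotZr) dot_mask walk_self_adjoint dot_mask.
apply: (@killed_walk_contraction _ _ _ I_gt0 T_gt0 _ _ delta) => //.
  exact: marked_density.
by rewrite card_ord.
Qed.

End Approximant.

(** * Balancing word length against number of steps *)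

Section ParameterChoice.
Variable R : realType.

(** Invert [1 / (1 + h) <= 1 - h/2 <= e^(-h/2)], the first inequality using [h <= 1]. *)
Lemma expR_half_le (h : R) : 0 <= h <= 1 -> expR (h / 2) <= 1 + h.
Proof.
move=> /andP[h_ge0 h_le1]; have h1_gt0 : 0 < 1 + h by lra.
rewrite -[leLHS]invrK -[leRHS]invrK lef_pV2 ?posrE ?invr_gt0 ?expR_gt0 //.
rewrite -expRN; apply: le_trans (expR_ge1Dx _).
by rewrite -[leLHS]mul1r ler_pdivrMr //; nra.
Qed.

(** Take [r] about [32 Z], cancelling the 32 of the density, and [m] about [4 L / h <= 23 Z]. Each
    rounding costs at most 1, and [55 Z + 2 <= 64 Z] as [Z >= 1]. *)
Lemma parameters (l k : nat) (Z L eps : R) :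
  (0 < l)%N -> (0 < k)%N -> 1 <= L -> 0 < Z -> 64 * Z < l%:R ->
  Z ^+ k.+1 = l%:R ^+ k * L ^+ 2 -> 0 < eps -> eps < 1 / 10 ->
  ln (1 / eps) <= L ->
  exists r m (h : R),
    [/\ (0 < r)%N, (2 * k <= r)%N, (r <= l)%N & (r + m)%:R <= 64 * Z] /\
    [/\ 0 < h, h <= 1, h ^+ 2 <= (r%:R / (32 * l%:R)) ^+ k / r%:R
      & 2 / eps <= (1 + h) ^+ m].
Proof.
move=> l_gt0 k_gt0 L_ge1 Z_gt0 Z_lt ZE eps_gt0 eps_lt ln_le.
have l_gt0R : 0 < l%:R :> R by rewrite ltr0n.
have L_gt0 : 0 < L by lra.
have Z_ge : l%:R ^+ k <= Z ^+ k.+1.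
  by rewrite ZE ler_peMr ?exprn_ge0 ?exprn_ege1.
have l_gt : 64 ^+ k.+1 < l%:R :> R.
  rewrite -(ltr_pM2r (exprn_gt0 k l_gt0R)) -exprS.
  apply: le_lt_trans (_ : (64 * Z) ^+ k.+1 < _).
    by rewrite exprMn ler_wpM2l ?exprn_ge0.
  by rewrite ltr_pXn2r // nnegrE ?mulr_ge0 ?ltW.
have Z_ge64 : 64 ^+ k <= Z.
  rewrite -(@ler_pXn2r _ k.+1) // ?nnegrE ?exprn_ge0 ?(ltW Z_gt0) //.
  apply: le_trans Z_ge; rewrite -exprM mulnC exprM.
  by apply: lerXn2r (ltW l_gt); rewrite nnegrE ?exprn_ge0.
have Z_gek : k%:R <= Z.
  by apply: le_trans Z_ge64; rewrite -natrX ler_nat ltnW // ltn_expl.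
have Z_ge1 : 1 <= Z by apply: le_trans Z_gek; rewrite ler1n.
have [r [r_ge r_le]] : exists r : nat, 32 * Z <= r%:R /\ r%:R <= 32 * Z + 1.
  have /truncn_itv/andP[le_t lt_t] : 0 <= 32 * Z by lra.
  exists (Num.truncn (32 * Z)).+1; split; first exact: ltW.
  by rewrite -natr1 lerD2r.
have r_gt0R : 0 < r%:R :> R by lra.
have r_gt0 : (0 < r)%N by rewrite -(ltr0n R).
have le_kr : (2 * k <= r)%N by rewrite -(ler_nat R) natrM; lra.
have rl : r%:R <= l%:R :> R by lra.
have le_rl : (r <= l)%N by rewrite -(ler_nat R).
pose delta : R := (r%:R / (32 * l%:R)) ^+ k.
have l32_gt0 : 0 < 32 * l%:R :> R by rewrite mulr_gt0.
have delta_gt0 : 0 < delta by rewrite exprn_gt0 ?divr_gt0.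
have delta_le1 : delta <= 1.
  rewrite exprn_ile1 ?divr_ge0 ?(ltW l32_gt0) // ler_pdivrMr //; lra.
pose h : R := Num.sqrt (delta / r%:R).
have dr_gt0 : 0 < delta / r%:R by rewrite divr_gt0.
have hE : h ^+ 2 = delta / r%:R by rewrite sqr_sqrtr // ltW.
have h_gt0 : 0 < h by rewrite sqrtr_gt0.
have h_le1 : h <= 1.
  rewrite -(@ler_pXn2r _ 2) // ?nnegrE ?(ltW h_gt0) // hE expr1n.
  by rewrite ler_pdivrMr // mul1r (le_trans delta_le1) // ler1n.
(* After squaring, [l^k L^2 = Z^(k+1)] and [(32 Z)^(k-1) <= r^(k-1)] bound the left side by
   [512 Z^2], and [23^2 = 529]. *)
have steps_le : 4 * L / h <= 23 * Z.
  rewrite ler_pdivrMr // -(@ler_pXn2r _ 2) // ?nnegrE; last 2 first.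
  - by rewrite mulr_ge0 ?ltW.
  - by rewrite !mulr_ge0 ?ltW.
  rewrite 2!exprMn [in leRHS]exprMn hE /delta expr_div_n exprMn.
  have pow_gt0 : 0 < 32 ^+ k * l%:R ^+ k * r%:R :> R.
    by rewrite !mulr_gt0 ?exprn_gt0.
  rewrite -(ler_pM2r pow_gt0).
  have -> : 4 ^+ 2 * L ^+ 2 * (32 ^+ k * l%:R ^+ k * r%:R) =
      16 * 32 ^+ k * Z ^+ k.+1 * r%:R by rewrite ZE; ring.
  have -> : 23 ^+ 2 * Z ^+ 2 * (r%:R ^+ k / (32 ^+ k * l%:R ^+ k) / r%:R) *
      (32 ^+ k * l%:R ^+ k * r%:R) = 529 * Z ^+ 2 * r%:R ^+ k.
    by field; rewrite !gt_eqF ?exprn_gt0.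
  case: (k) k_gt0 => // j _; rewrite (exprS r%:R) (exprS 32).
  have : (32 * Z) ^+ j <= r%:R ^+ j.
    by apply: lerXn2r => //; rewrite nnegrE ?mulr_ge0 ?ltW.
  rewrite exprMn => le_j; have ZZr_ge0 : 0 <= 512 * Z ^+ 2 * r%:R.
    by rewrite !mulr_ge0 ?exprn_ge0 ?ltW.
  have := ler_wpM2l ZZr_ge0 le_j.
  have : 0 <= Z ^+ 2 * r%:R * r%:R ^+ j by rewrite !mulr_ge0 ?exprn_ge0 ?ltW.
  rewrite !exprS; lra.
have [m [m_ge m_le]] : exists m : nat, 4 * L / h <= m%:R /\ m%:R <= 4 * L / h + 1.
  have /truncn_itv/andP[le_t lt_t] : 0 <= 4 * L / h.
    by rewrite divr_ge0 ?mulr_ge0 ?ltW.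
  exists (Num.truncn (4 * L / h)).+1; split; first exact: ltW.
  by rewrite -natr1 lerD2r.
exists r, m, h; split; split=> //.
- by rewrite natrD; lra.
- by rewrite hE.
(* The chain is [(1 + h)^m >= e^(mh/2) >= e^(2L) >= eps^-2 >= 2 / eps]. *)
apply: le_trans (_ : expR (m%:R * (h / 2)) <= _); last first.
  rewrite expRM_natl; apply: lerXn2r; rewrite ?nnegrE ?expR_ge0 ?addr_ge0 ?(ltW h_gt0) //.
  by apply: expR_half_le; rewrite ltW.
apply: le_trans (_ : expR (ln (1 / eps) * 2%:R) <= _); last first.
  rewrite ler_expR; move: m_ge; rewrite ler_pdivrMr //; lra.
have inv_gt0 : 0 < 1 / eps by rewrite divr_gt0.
rewrite expRM_natr lnK ?posrE // -[2 / eps]mulr1 -mulrA expr2 mul1r.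
have : 2 <= eps^-1 by rewrite -[eps^-1]mul1r ler_pdivlMr //; lra.
by rewrite mulr1 => ge2; rewrite ler_pM2r ?invr_gt0.
Qed.

End ParameterChoice.

(** * Assembly with constant 64 *)

Theorem theorem8 (R : realType) :
  exists C : R, 0 < C /\
  forall (l k : nat) (eps : R) (g : cube l -> bool),
    (1 <= l)%N -> (1 <= k)%N -> 0 < eps -> eps < 1 / 10 ->
    computed_by_kcnf k g ->
    let d : R := C * l%:R `^ (k%:R / (k%:R + 1))
                   * (log2 (1 / eps)) `^ (2 / (k%:R + 1)) in
    exists q : {mpoly R[l]},
      [/\ (mpoly_degree q)%:R <= d,
          forall x : cube l, g x = true -> mpoly_eval q x = 1,
          forall x : cube l, `|mpoly_eval q x - (g x)%:R| <= eps
        & coef_abs_sum q <= 32 `^ d].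
Proof.
exists 64; split=> [|l k eps g l_gt0 k_gt0 eps_gt0 eps_lt [phi phi_width phiE]].
  by [].
set L := log2 _; rewrite -mulrA; set Z := (_ `^ _ * _) => d.
have degree_norm_le n (q : {mpoly R[l]}) : n%:R <= d ->
    (msize q <= n.+1)%N -> coef_abs_sum q <= 32 ^+ n ->
    (mpoly_degree q)%:R <= d /\ coef_abs_sum q <= 32 `^ d.
  move=> n_le q_size q_norm; split.
    apply: le_trans n_le; rewrite ler_nat /mpoly_degree.
    by case: (msize q) q_size.
  apply: le_trans q_norm _; rewrite -powR_mulrn //; apply: ler_powR => //.
  by rewrite ler1n.
(* If [d >= l], the exact expansion of [g] has degree at most [l] and norm at most [3^l]. Otherwise
   [64 Z < l], as the parameter choice requires. *)
have [l_le|d_lt] := lerP l%:R d.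
  have g_junta : junta (enum 'I_l) (fun x => (g x)%:R : R).
    split=> [x y xy|x]; last by rewrite ger0_norm ?ler0n // lern1 leq_b1.
    by congr (g _)%:R; apply/ffunP => i; rewrite xy // mem_enum.
  have [q [q_size q_norm qE]] := junta_representable g_junta.
  rewrite size_enum_ord in q_size q_norm.
  have [] := degree_norm_le _ _ l_le q_size.
    by apply: le_trans q_norm _; apply: lerXn2r; rewrite ?nnegrE // ler_nat.
  exists q; split=> // x; rewrite qE; first by move->.
  by rewrite subrr normr0 ltW.
have ln2_gt0 : 0 < ln 2 :> R by rewrite ln_gt0 // ltr1n.
(* Hence the binary logarithm [L] dominates the natural one. *)
have ln2_le1 : ln 2 <= 1 :> R.
  by apply: (@le_ln1Dx R 1); lra.
have inv_ge2 : 2 <= 1 / eps by rewrite ler_pdivlMr //; lra.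
have ln_ge : ln 2 <= ln (1 / eps) by rewrite ler_ln // posrE; lra.
have L_ge1 : 1 <= L by rewrite /L /log2 ler_pdivlMr // (mul1r (ln 2)).
have ln_le : ln (1 / eps) <= L.
  rewrite /L /log2 ler_pdivlMr // ler_piMr //; lra.
have k1_neq0 : k%:R + 1 != 0 :> R by rewrite natr1 pnatr_eq0.
have Z_gt0 : 0 < Z by rewrite mulr_gt0 // powR_gt0 ?ltr0n //; lra.
have ZE : Z ^+ k.+1 = l%:R ^+ k * L ^+ 2.
  rewrite exprMn -!powR_mulrn ?powR_ge0 //; last by lra.
  by rewrite -!powRrM -natr1 !divfK.
have [r [m [h [[r_gt0 le_kr le_rl le_d] [h_gt0 h_le1 h_delta le_m]]]]] :=
  parameters l_gt0 k_gt0 L_ge1 Z_gt0 d_lt ZE eps_gt0 eps_lt ln_le.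
have [q [q_size q_norm q1 q0]] :=
  approximant l_gt0 phi_width r_gt0 le_kr le_rl h_gt0 h_le1 h_delta eps_gt0 le_m.
have [] := degree_norm_le _ _ le_d q_size.
  (* Both bases, 3 and 13, are below 32. *)
  apply: le_trans q_norm _; rewrite exprD.
  by apply: ler_pM; rewrite ?exprn_ge0 //; apply: lerXn2r; rewrite ?nnegrE // ler_nat.
exists q; split=> // x; first by rewrite -phiE; exact: q1.
rewrite -phiE; have [x_phi|x_phi] := boolP (cnf_eval x phi).
  by rewrite q1 // subrr normr0 ltW.
by rewrite subr0 q0.
Qed.
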